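(* Let $A,\Delta A\in\mathbb{C}^{n\times n}$ be Hermitian and let $A(t)=A+t\,\Delta A$ for $t\in\mathbb{R}$. Let $r_1,\dots,r_k$ be positive integers with $r_1+\cdots+r_k=n$. Suppose that for all $t\in\mathbb{R}$ $$A(t)=U(t)\Lambda(t)U(t)^H,$$ where $U(t)=[U_1(t),\ldots,U_k(t)]$ with $U_j(t)\in\mathbb{C}^{n\times r_j}$ is unitary and analytic in $t$, $\Lambda(t)=\mathrm{diag}(\Lambda_1(t),\ldots,\Lambda_k(t))$ with $\Lambda_j(t)\in\mathbb{C}^{r_j\times r_j}$ is block diagonal and analytic in $t$ (the blocks $\Lambda_j(t)$ need not be diagonal), and $$U_j(t)^H\dot U_j(t)=0,\qquad j=1,\ldots,k .$$ Define $$\delta_{1i}(t)=\min_{\lambda_1\in\lambda(\Lambda_1(t)),\ \lambda_2\in\lambda(\Lambda_i(t))}|\lambda_1-\lambda_2|,\qquad \delta_1(t)=\min_{i\ne 1}\delta_{1i}(t),\qquad \delta_{1,\min}=\min_{0\le t\le 1}\delta_1(t),$$ and put $U_1=U_1(0)$, $\widetilde U_1=U_1(1)$, $\Lambda_1=\Lambda_1(0)$, $\widetilde\Lambda_1=\Lambda_1(1)$. If $\|\Delta A\|_2<\delta_{1,\min}$, then $$\left(1-\frac{\|\Delta A\|_2}{\delta_{1,\min}}\right)^2\|\mathrm{Eig}^{\downarrow}(\widetilde\Lambda_1)-\mathrm{Eig}^{\downarrow}(\Lambda_1)\|_F^2+\left(\delta_{1,\min}-\|\Delta A\|_2\right)^2\|\widetilde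 U_1-U_1\|_F^2\le\|\Delta A\,U_1\|_F^2 .$$
   Context: $X^H$ is the conjugate transpose, $\|\cdot\|_F$ the Frobenius norm, $\|\cdot\|_2$ the spectral norm, $\lambda(X)$ the spectrum of a square matrix $X$, and $\dot F(t)=dF(t)/dt$. ''Analytic'' means real-analytic in the real variable $t$ (entrywise). For a Hermitian matrix $X$, $\mathrm{Eig}^{\downarrow}(X)$ denotes the diagonal matrix of the same size whose diagonal entries are the eigenvalues of $X$ (with multiplicity) in nonincreasing order. Convention for $k=1$: a minimum over the empty set is $+\infty$, with $c/\infty=0$ for finite $c$ and $\infty\cdot 0=0$ (in that case $\widetilde U_1=U_1$). *)

(* Defs.v *)
From mathcomp Require Export all_boot all_order all_algebra complex.
From mathcomp Require Export all_classical all_reals all_analysis.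

Set Implicit Arguments.
Unset Strict Implicit.
Unset Printing Implicit Defensive.

Import Order.TTheory GRing.Theory Num.Theory.
Import numFieldTopology.Exports numFieldNormedType.Exports.

Local Open Scope classical_set_scope.
Local Open Scope complex_scope.
Local Open Scope ring_scope.

Section Analytic.
Context {R : realType}.

Definition real_analytic (f : R -> R) : Prop :=
  forall t0 : R, exists a : R^nat,
    \forall h \near 0, pseries a h @ \oo --> f (t0 + h).

(* [R[i]] carries no normed [R]-module structure in the library, so
   analyticity and differentiation in the real variable are taken on real and
   imaginary parts. *)
Definition analytic_mx m n (F : R -> 'M[R[i]]_(m, n)) : Prop :=
  forall i j, real_analytic (fun t => complex.Re (F t i j)) /\
              real_analytic (fun t => complex.Im (F t i j)).

Definition ddt_mx m n (F : R -> 'M[R[i]]_(m, n)) (t : R) : 'M[R[i]]_(m, n) :=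
  \matrix_(i, j) @Complex R (derive1 (fun s => complex.Re (F s i j)) t)
                            (derive1 (fun s => complex.Im (F s i j)) t).

End Analytic.

Section MatrixNorms.
Context {R : realType}.

Definition cmod (z : R[i]) : R := complex.Re (`|z| : R[i]).

Definition frob m n (X : 'M[R[i]]_(m, n)) : R :=
  Num.sqrt (\sum_i \sum_j cmod (X i j) ^+ 2).

(* [frob] of a column is its Euclidean norm. *)
Definition spectral_norm m n (X : 'M[R[i]]_(m, n)) : R :=
  sup [set frob (X *m v) | v in [set v : 'cV[R[i]]_n | frob v <= 1]].

End MatrixNorms.

Section Eigenvalues.
Context {R : realType}.

(* Eigenvalues repeated according to multiplicity, in unspecified order. *)
Definition eigenvalues n (X : 'M[R[i]]_n) : seq R[i] :=
  sval (closed_field_poly_normal (char_poly X)).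

Lemma eigenvaluesP n (X : 'M[R[i]]_n) :
  char_poly X = \prod_(z <- eigenvalues X) ('X - z%:P).
Proof.
rewrite /eigenvalues; case: closed_field_poly_normal => s /= {1}->.
by rewrite (monicP (char_poly_monic X)) scale1r.
Qed.

(* The order on [R[i]] is partial, but it is total on the eigenvalues of a
   Hermitian matrix, which are real. *)
Definition Eig_down n (X : 'M[R[i]]_n) : 'M[R[i]]_n :=
  diag_mx (\row_(i < n) (sort >=%R (eigenvalues X))`_i).

End Eigenvalues.

Section Gaps.
Context {R : realType} (k : nat) (r : 'I_k.+1 -> nat).
Variable L : forall j : 'I_k.+1, R -> 'M[R[i]]_(r j).

Local Open Scope ereal_scope.

(* The distinguished first block has index [ord0].  The infimum ranges over a
   finite set, nonempty when the blocks are. *)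
Definition delta1i (i : 'I_k.+1) (t : R) : \bar R :=
  ereal_inf [set (cmod (z1 - z2))%:E
            | z1 in [set z | eigenvalue (L ord0 t) z]
            & z2 in [set z | eigenvalue (L i t) z]].

(* [+oo] when there is only one block. *)
Definition delta1 (t : R) : \bar R :=
  \big[Order.min/+oo]_(i < k.+1 | i != ord0) delta1i i t.

(* An infimum: attained when [L] is continuous with nonempty blocks. *)
Definition delta1_min : \bar R :=
  ereal_inf [set delta1 t | t in `[0%R, 1%R]].

End Gaps.

(* Main.v *)
Require Import Defs.
From mathcomp Require Import all_boot all_order all_algebra complex.
From mathcomp Require Import all_classical all_reals all_analysis.
From mathcomp Require Import perm ring lra.

Set Implicit Arguments.
Unset Strict Implicit.
Unset Printing Implicit Defensive.

Import Order.TTheory GRing.Theory Num.Theory.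

Local Open Scope classical_set_scope.
Local Open Scope complex_scope.
Local Open Scope sesquilinear_scope.
Local Open Scope ring_scope.

(** Write s for the spectral norm of dA, a for the Frobenius norm of dA U1(0),
    and let d be a real number with s < d <= delta_(1,min).

    Differentiating the invariance relation A(t) U1 = U1 L1 and multiplying on
    the left by Uj^H gives, thanks to the gauge condition,
      U1^H dA U1 = L1'    and    Uj^H dA U1 = X L1 - Lj X  with X = Uj^H U1'.
    As L1 and Lj are Hermitian with spectra at distance at least d, the
    Sylvester operator X |-> X L1 - Lj X expands Frobenius norms by a factor at
    least d ([sylvester_gap]).  Summing over the orthogonal blocks yields the
    pointwise estimate ([velocity_bound])
      |L1'(t)|^2 + d^2 |U1'(t)|^2 <= |dA U1(t)|^2.

    The right-hand side is taken at time t rather than at time 0, but it is at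
    most (a + s m)^2, where m is the supremum of |U1(t) - U1(0)| over [0, 1].
    In particular |U1'| <= (a + s m) / d, so the mean value inequality gives
    m <= (a + s m) / d, which solves to a + s m <= a / (1 - s / d).  The speed
    of the curve t |-> (L1(t), d U1(t)) is thus at most a / (1 - s / d) on
    [0, 1], and so is the distance between its endpoints: this is the desired
    bound with |L1(1) - L1(0)| in place of the distance between the ordered
    eigenvalues ([block_perturbation_bound]).  The latter distance is
    at most |L1(1) - L1(0)| by the Hoffman-Wielandt inequality ([hoffman_wielandt]).

    Since the bound holds for every admissible real d, the case of an infinite
    gap follows by letting d grow ([ereal_gap_bound]). *)

(** * The real inner product and the Frobenius and spectral norms *)

Section FrobeniusNorm.
Context {R : realType}.
Local Notation C := R[i].
Local Notation Re := (@complex.Re R).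
Local Notation Im := (@complex.Im R).

Lemma ReD (x y : C) : Re (x + y) = Re x + Re y.
Proof. by case: x; case: y. Qed.

Lemma ImD (x y : C) : Im (x + y) = Im x + Im y.
Proof. by case: x; case: y. Qed.

Lemma ReM (x y : C) : Re (x * y) = Re x * Re y - Im x * Im y.
Proof. by case: x; case: y. Qed.

Lemma ImM (x y : C) : Im (x * y) = Re x * Im y + Im x * Re y.
Proof. by case: x; case: y. Qed.

Lemma Re_sum (I : Type) (s : seq I) (P : pred I) (F : I -> C) :
  Re (\sum_(i <- s | P i) F i) = \sum_(i <- s | P i) Re (F i).
Proof. exact: (big_morph _ ReD). Qed.

Lemma Im_sum (I : Type) (s : seq I) (P : pred I) (F : I -> C) :
  Im (\sum_(i <- s | P i) F i) = \sum_(i <- s | P i) Im (F i).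
Proof. exact: (big_morph _ ImD). Qed.

Lemma Re_conjM (x y : C) : Re (x^* * y) = Re x * Re y + Im x * Im y.
Proof. by case: x => a b; case: y => c d /=; rewrite mulNr opprK. Qed.

Lemma cmod_sqr (z : C) : cmod z ^+ 2 = Re z ^+ 2 + Im z ^+ 2.
Proof. by rewrite /cmod normc_def /= sqr_sqrtr // addr_ge0 ?sqr_ge0. Qed.

Lemma cmod_ge0 (z : C) : 0 <= cmod z.
Proof. by rewrite /cmod normc_def /= sqrtr_ge0. Qed.

Lemma cmodM (x y : C) : cmod (x * y) = cmod x * cmod y.
Proof.
apply/(@pexpIrn _ 2); rewrite ?nnegrE ?mulr_ge0 ?cmod_ge0 //.
by rewrite exprMn !cmod_sqr ReM ImM; ring.
Qed.

(** The Euclidean inner product on complex matrices seen as real vectors.  Its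
    real values let the mean value theorem for real functions apply to matrix
    curves. *)
Definition dotR m n (X Y : 'M[C]_(m, n)) : R := Re (\tr (X^t* *m Y)).

Lemma dotRE m n (X Y : 'M[C]_(m, n)) :
  dotR X Y = \sum_i \sum_j (Re (X i j) * Re (Y i j) + Im (X i j) * Im (Y i j)).
Proof.
rewrite /dotR /mxtrace Re_sum exchange_big /=; apply: eq_bigr => j _.
rewrite mxE Re_sum; apply: eq_bigr => i _.
by rewrite !mxE -Re_conjM.
Qed.

Lemma frob_sqrE m n (X : 'M[C]_(m, n)) :
  frob X ^+ 2 = \sum_i \sum_j cmod (X i j) ^+ 2.
Proof.
by rewrite /frob sqr_sqrtr //; do 2!apply: sumr_ge0 => ? _; exact: sqr_ge0.
Qed.

Lemma frob_sqr m n (X : 'M[C]_(m, n)) : frob X ^+ 2 = dotR X X.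
Proof.
rewrite frob_sqrE dotRE; apply: eq_bigr => i _; apply: eq_bigr => j _.
by rewrite cmod_sqr !expr2.
Qed.

Lemma frob_ge0 m n (X : 'M[C]_(m, n)) : 0 <= frob X.
Proof. exact: sqrtr_ge0. Qed.

Lemma dotRC m n (X Y : 'M[C]_(m, n)) : dotR X Y = dotR Y X.
Proof.
rewrite !dotRE; apply: eq_bigr => i _; apply: eq_bigr => j _.
by rewrite mulrC [Im _ * _]mulrC.
Qed.

Lemma dotRDr m n (X Y Z : 'M[C]_(m, n)) : dotR X (Y + Z) = dotR X Y + dotR X Z.
Proof. by rewrite /dotR mulmxDr mxtraceD ReD. Qed.

Lemma dotRZr m n (a : R) (X Y : 'M[C]_(m, n)) :
  dotR X (a%:C *: Y) = a * dotR X Y.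
Proof. by rewrite /dotR -scalemxAr mxtraceZ ReM /= mul0r subr0. Qed.

Lemma dotRDl m n (X Y Z : 'M[C]_(m, n)) : dotR (Y + Z) X = dotR Y X + dotR Z X.
Proof. by rewrite dotRC dotRDr !(dotRC X). Qed.

Lemma dotRZl m n (a : R) (X Y : 'M[C]_(m, n)) :
  dotR (a%:C *: X) Y = a * dotR X Y.
Proof. by rewrite dotRC dotRZr dotRC. Qed.

Lemma dotRNr m n (X Y : 'M[C]_(m, n)) : dotR X (- Y) = - dotR X Y.
Proof.
rewrite -mulN1r -dotRZr; congr dotR; apply/matrixP => i j; rewrite !mxE.
by rewrite rmorphN rmorph1 mulN1r.
Qed.

Lemma dotRNl m n (X Y : 'M[C]_(m, n)) : dotR (- X) Y = - dotR X Y.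
Proof. by rewrite dotRC dotRNr dotRC. Qed.

Lemma frobN m n (X : 'M[C]_(m, n)) : frob (- X) = frob X.
Proof.
apply/(@pexpIrn _ 2); rewrite ?nnegrE ?frob_ge0 //.
by rewrite !frob_sqr dotRNr dotRNl opprK.
Qed.

Lemma frob0 m n : frob (0 : 'M[C]_(m, n)) = 0.
Proof.
apply/eqP; rewrite -sqrf_eq0 frob_sqr /dotR mulmx0 mxtrace0 //.
Qed.

Lemma frobZ m n (z : C) (X : 'M[C]_(m, n)) : frob (z *: X) = cmod z * frob X.
Proof.
apply/(@pexpIrn _ 2); rewrite ?nnegrE ?mulr_ge0 ?frob_ge0 ?cmod_ge0 //.
rewrite exprMn !frob_sqr !dotRE mulr_sumr; apply: eq_bigr => i _.
rewrite mulr_sumr; apply: eq_bigr => j _.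
by rewrite cmod_sqr mxE ReM ImM; ring.
Qed.

Lemma frob_entry m n (X : 'M[C]_(m, n)) i j : cmod (X i j) <= frob X.
Proof.
rewrite -(@ler_pXn2r _ 2) ?nnegrE ?frob_ge0 ?cmod_ge0 //.
rewrite frob_sqr dotRE (bigD1 i) //= (bigD1 j) //= cmod_sqr !expr2 -addrA.
rewrite lerDl addr_ge0 // sumr_ge0 // => ? _.
  by rewrite -!expr2 addr_ge0 ?sqr_ge0.
by apply: sumr_ge0 => ? _; rewrite -!expr2 addr_ge0 ?sqr_ge0.
Qed.

Lemma frob_eq0 m n (X : 'M[C]_(m, n)) : frob X = 0 -> X = 0.
Proof.
move=> X0; apply/matrixP => i j; apply/eqP; have := frob_entry X i j.
rewrite X0 => h; have /eqP : cmod (X i j) = 0 by apply/le_anti; rewrite h cmod_ge0.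
rewrite -sqrf_eq0 cmod_sqr paddr_eq0 ?sqr_ge0 // !sqrf_eq0 mxE.
by rewrite eq_complex /=.
Qed.

(** Cauchy-Schwarz, from the nonnegativity of the square of |Y| X - |X| Y. *)
Lemma dotR_le m n (X Y : 'M[C]_(m, n)) : dotR X Y <= frob X * frob Y.
Proof.
have [/eqP|] := eqVneq (frob X * frob Y) 0; last first.
  rewrite neq_lt ltNge mulr_ge0 ?frob_ge0 //= => xy_gt0.
  have: 0 <= frob ((frob Y)%:C *: X - (frob X)%:C *: Y) ^+ 2 by apply: sqr_ge0.
  rewrite frob_sqr dotRDl dotRNl !dotRDr !dotRNr !dotRZl !dotRZr -!frob_sqr.
  rewrite (dotRC Y X) => h.
  rewrite -(ler_pM2l xy_gt0); lra.
by rewrite mulf_eq0 => /orP[]/eqP/[dup]/frob_eq0 -> ->;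
  rewrite /dotR ?mulmx0 ?trmx0 ?map_mx0 ?mul0mx mxtrace0 ?mulr0 ?mul0r.
Qed.

Lemma frobD m n (X Y : 'M[C]_(m, n)) : frob (X + Y) <= frob X + frob Y.
Proof.
rewrite -(@ler_pXn2r _ 2) ?nnegrE ?addr_ge0 ?frob_ge0 //.
rewrite frob_sqr dotRDl !dotRDr -!frob_sqr (dotRC Y X).
have := dotR_le X Y; rewrite sqrrD; lra.
Qed.

Lemma frob_unitaryl m n p (V : 'M[C]_(m, n)) (X : 'M[C]_(n, p)) :
  V^t* *m V = 1%:M -> frob (V *m X) = frob X.
Proof.
move=> VV; apply/(@pexpIrn _ 2); rewrite ?nnegrE ?frob_ge0 //.
by rewrite !frob_sqr /dotR trmx_mul map_mxM -mulmxA (mulmxA _ V) VV mul1mx.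
Qed.

Lemma frob_unitaryr m n p (W : 'M[C]_(n, p)) (X : 'M[C]_(m, n)) :
  W *m W^t* = 1%:M -> frob (X *m W) = frob X.
Proof.
move=> WW; apply/(@pexpIrn _ 2); rewrite ?nnegrE ?frob_ge0 //.
rewrite !frob_sqr /dotR trmx_mul map_mxM mxtrace_mulC -mulmxA (mulmxA W) WW.
by rewrite mul1mx mxtrace_mulC.
Qed.

(** Pythagoras for a resolution of the identity: insert the sum of the
    V_i V_i^H between X^H and X in the trace of X^H X. *)
Lemma frob_sum_resolution m p (I : finType) (q : I -> nat)
    (V : forall i, 'M[C]_(m, q i)) (X : 'M[C]_(m, p)) :
  \sum_i V i *m (V i)^t* = 1%:M ->
  frob X ^+ 2 = \sum_i frob ((V i)^t* *m X) ^+ 2.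
Proof.
move=> V1; rewrite frob_sqr /dotR -[X in _ *m X]mul1mx -V1 mulmx_suml.
rewrite mulmx_sumr [\tr _]raddf_sum Re_sum; apply: eq_bigr => i _.
by rewrite frob_sqr /dotR trmx_mul map_mxM /= trmxCK !mulmxA.
Qed.

Lemma frob_col_mx m1 m2 n (X : 'M[C]_(m1, n)) (Y : 'M[C]_(m2, n)) :
  frob (col_mx X Y) ^+ 2 = frob X ^+ 2 + frob Y ^+ 2.
Proof.
by rewrite !frob_sqr /dotR tr_col_mx map_row_mx mul_row_col mxtraceD ReD.
Qed.

Lemma frob_cols m n (X : 'M[C]_(m, n)) :
  frob X ^+ 2 = \sum_j frob (col j X) ^+ 2.
Proof.
rewrite frob_sqr dotRE exchange_big /=; apply: eq_bigr => j _.
rewrite frob_sqr dotRE; apply: eq_bigr => i _.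
by rewrite big_ord1 !mxE.
Qed.

Lemma frob_sum m n (I : Type) (s : seq I) (F : I -> 'M[C]_(m, n)) :
  frob (\sum_(i <- s) F i) <= \sum_(i <- s) frob (F i).
Proof.
elim: s => [|i s IH]; first by rewrite !big_nil frob0.
by rewrite !big_cons (le_trans (frobD _ _)) // lerD2l.
Qed.

(** The supremum that defines the spectral norm is over a bounded set, since
    X v is a combination of the columns of X with coefficients of modulus at
    most |v| <= 1. *)
Lemma has_sup_spectral m n (X : 'M[C]_(m, n)) :
  has_sup [set frob (X *m v) | v in [set v : 'cV[C]_n | frob v <= 1]].
Proof.
split; first by exists (frob (X *m (0 : 'cV_n))), 0 => //=; rewrite frob0.
exists (\sum_j frob (col j X)) => _ [w /= w1 <-].
have -> : X *m w = \sum_j w j 0 *: col j X.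
  apply/matrixP => i j; rewrite !mxE summxE; apply: eq_bigr => l _.
  by rewrite !mxE (ord1 j) mulrC.
apply: le_trans (frob_sum _ _) _; apply: ler_sum => j _.
rewrite frobZ ler_piMl ?frob_ge0 //; exact: le_trans (frob_entry _ _ _) w1.
Qed.

Lemma spectral_norm_ge0 m n (X : 'M[C]_(m, n)) : 0 <= spectral_norm X.
Proof.
apply: le_trans (frob_ge0 (X *m (0 : 'cV_n))) _.
apply: sup_upper_bound; first exact: has_sup_spectral.
by exists 0 => //=; rewrite frob0.
Qed.

Lemma cmod_real (a : R) : cmod a%:C = `|a|.
Proof. by rewrite /cmod normc_def /= expr0n addr0 sqrtr_sqr. Qed.

Lemma frob_mulmx_cV m n (X : 'M[C]_(m, n)) (v : 'cV[C]_n) :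
  frob (X *m v) <= spectral_norm X * frob v.
Proof.
have [/frob_eq0 ->|v_neq0] := eqVneq (frob v) 0.
  by rewrite mulmx0 !frob0 mulr0.
have v_gt0 : 0 < frob v by rewrite lt_neqAle eq_sym v_neq0 frob_ge0.
have inv0 : 0 <= (frob v)^-1 by rewrite invr_ge0 frob_ge0.
rewrite -ler_pdivrMr // mulrC -{1}(ger0_norm inv0) -cmod_real -frobZ scalemxAr.
apply: sup_upper_bound; first exact: has_sup_spectral.
by eexists; last reflexivity; rewrite /= frobZ cmod_real ger0_norm // mulVf.
Qed.

Lemma frob_mulmx_spectral m n p (X : 'M[C]_(m, n)) (Y : 'M[C]_(n, p)) :
  frob (X *m Y) <= spectral_norm X * frob Y.
Proof.
have s0 := spectral_norm_ge0 X.
rewrite -(@ler_pXn2r _ 2) ?nnegrE ?mulr_ge0 ?frob_ge0 //.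
rewrite exprMn !frob_cols mulr_sumr; apply: ler_sum => j _.
rewrite -exprMn ler_pXn2r ?nnegrE ?mulr_ge0 ?frob_ge0 //.
by rewrite colE -mulmxA -colE frob_mulmx_cV.
Qed.

End FrobeniusNorm.

(** * Spectral inequalities for Hermitian matrices *)

Section HoffmanWielandt.
Context {R : realType}.
Local Notation C := R[i].

(** Summation by parts in inductive form: replacing the lower bound c by the
    last value of l leaves a multiple of the total sum of d, which is
    nonnegative. *)
Lemma abel_ge n (l d : 'I_n -> R) (c : R) :
  (forall i j : 'I_n, (i <= j)%N -> l j <= l i) -> (forall i, c <= l i) ->
  (forall k : 'I_n, 0 <= \sum_(i < n | (i <= k)%N) d i) ->
  0 <= \sum_i (l i - c) * d i.
Proof.
elim: n l d c => [|n IH] l d c l_dec cl d_ge0; first by rewrite big_ord0.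
pose w := widen_ord (leqnSn n).
rewrite big_ord_recr /=.
have -> : \sum_(i < n) (l (w i) - c) * d (w i) + (l ord_max - c) * d ord_max =
    \sum_(i < n) (l (w i) - l ord_max) * d (w i) + (l ord_max - c) * \sum_i d i.
  rewrite [in RHS]big_ord_recr /= mulrDr addrA; congr (_ + _).
  rewrite mulr_sumr -big_split /=; apply: eq_bigr => i _; ring.
apply: addr_ge0; last first.
  apply: mulr_ge0; first by rewrite subr_ge0.
  by have := d_ge0 ord_max; under eq_bigl do rewrite -ltnS ltn_ord.
apply: (IH (l \o w) (d \o w)) => [i j ij|i|k] /=.
- exact: l_dec.
- by apply: l_dec; rewrite /= ltnW.
- have := d_ge0 (w k); rewrite big_mkcond big_ord_recr /= -big_mkcond /=.
  by rewrite leqNgt ltn_ord /= addr0.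
Qed.

(** P m is majorized by m: the sum of its first k entries weights m with
    coefficients in [0, 1] of total mass k, so it is at most the sum of the k
    largest entries of m.  Summation by parts against l concludes. *)
Lemma doubly_stochastic_rearrangement n (P : 'I_n -> 'I_n -> R) (l m : 'I_n -> R) :
  (forall i j, 0 <= P i j) ->
  (forall i, \sum_j P i j = 1) -> (forall j, \sum_i P i j = 1) ->
  (forall i j : 'I_n, (i <= j)%N -> l j <= l i) ->
  (forall i j : 'I_n, (i <= j)%N -> m j <= m i) ->
  \sum_i \sum_j P i j * (l i * m j) <= \sum_i l i * m i.
Proof.
move=> P0 Prow Pcol l_dec m_dec; case: n => [|n] in P l m P0 Prow Pcol l_dec m_dec *.
  by rewrite !big_ord0.
pose d i := m i - \sum_j P i j * m j.
have d_sum : \sum_i d i = 0.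
  rewrite sumrB exchange_big /= [X in _ - X](eq_bigr m) ?subrr // => j _.
  by rewrite -mulr_suml Pcol mul1r.
rewrite -subr_ge0.
have -> : \sum_i l i * m i - \sum_i \sum_j P i j * (l i * m j) =
          \sum_i (l i - l ord_max) * d i.
  under [RHS]eq_bigr do rewrite mulrBl.
  rewrite sumrB -mulr_sumr d_sum mulr0 subr0 -sumrB; apply: eq_bigr => i _.
  by rewrite mulrBr mulr_sumr; congr (_ - _); apply: eq_bigr => j _; ring.
apply: abel_ge => // [i|k]; first by apply: l_dec; rewrite -ltnS.
(* [c j] is the weight of m j in the sum of the entries of index <= k of P m. *)
pose c j := \sum_(i < n.+1 | (i <= k)%N) P i j.
have cE : \sum_j c j = \sum_(j < n.+1 | (j <= k)%N) 1.
  by rewrite exchange_big /=; apply: eq_bigr => i _; rewrite Prow.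
have c_le1 j : c j <= 1.
  rewrite -(Pcol j) /c big_mkcond; apply: ler_sum => i _.
  by case: ifP.
have c_ge0 j : 0 <= c j by apply: sumr_ge0.
rewrite sumrB exchange_big /=.
under [X in _ - X]eq_bigr do rewrite -mulr_suml -/(c _).
rewrite [X in X - _]big_mkcond -sumrB.
(* The weights [i <= k] and [c i] have the same total mass, so m can be
   shifted by m k; then each term is a product of factors of equal sign. *)
suff -> : \sum_(i < n.+1) ((if (i <= k)%N then m i else 0) - c i * m i) =
    \sum_(i < n.+1) ((i <= k)%N%:R - c i) * (m i - m k).
  apply: sumr_ge0 => i _; case: (leqP i k) => ik.
    by apply: mulr_ge0; rewrite subr_ge0 // m_dec.
  by rewrite sub0r mulr_le0 ?oppr_le0 // subr_le0 m_dec // ltnW.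
have c0 : \sum_(i < n.+1) ((i <= k)%N%:R - c i) = 0.
  rewrite sumrB cE [X in _ - X]big_mkcond -sumrB big1 // => i _.
  by case: ifP; rewrite subrr.
under [RHS]eq_bigr do rewrite mulrBr.
rewrite [RHS]sumrB -mulr_suml c0 mul0r subr0; apply: eq_bigr => i _.
by rewrite mulrBl; case: ifP; rewrite ?mul1r ?mul0r.
Qed.

Definition rdiag n (l : 'I_n -> R) : 'M[C]_n := diag_mx (\row_i (l i)%:C).

Lemma rdiag_mull m n (l : 'I_m -> R) (Z : 'M[C]_(m, n)) i j :
  (rdiag l *m Z) i j = (l i)%:C * Z i j.
Proof. by rewrite mul_diag_mx !mxE. Qed.

Lemma rdiag_mulr m n (l : 'I_n -> R) (Z : 'M[C]_(m, n)) i j :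
  (Z *m rdiag l) i j = (l j)%:C * Z i j.
Proof. by rewrite mul_mx_diag !mxE mulrC. Qed.

(** In eigenbases of the two Hermitian matrices the Sylvester operator acts
    entrywise, as multiplication by l i - k j.  Both the expansion estimate
    [sylvester_gap] and, with Z = 1, the Hoffman-Wielandt inequality are read
    off from this formula. *)
Lemma frob_sylvester_diag m n (V : 'M[C]_m) (W : 'M[C]_n) l k
    (Z : 'M[C]_(m, n)) :
  V \is unitarymx -> W \is unitarymx ->
  frob (V^t* *m rdiag l *m V *m Z - Z *m (W^t* *m rdiag k *m W)) ^+ 2 =
  \sum_i \sum_j (l i - k j) ^+ 2 * cmod ((V *m Z *m W^t*) i j) ^+ 2.
Proof.
move=> Vu Wu.
have VV := unitarymxP Vu; have WW := unitarymxP Wu.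
have VV' := mulmx1C VV; have WW' := mulmx1C WW.
set Y := _ - _.
rewrite -(@frob_unitaryl _ _ _ _ V) // -(@frob_unitaryr _ _ _ _ (W^t*)) ?trmxCK //.
have -> : V *m Y *m W^t* = rdiag l *m (V *m Z *m W^t*) - V *m Z *m W^t* *m rdiag k.
  rewrite mulmxBr mulmxBl !mulmxA VV mul1mx; congr (_ - _).
  by rewrite mulmxtVK.
rewrite frob_sqrE; apply: eq_bigr => i _; apply: eq_bigr => j _.
have -> : (rdiag l *m (V *m Z *m W^t*) - V *m Z *m W^t* *m rdiag k) i j =
    (rdiag l *m (V *m Z *m W^t*)) i j - (V *m Z *m W^t* *m rdiag k) i j.
  by rewrite [LHS]mxE; congr (_ + _); rewrite mxE.
rewrite rdiag_mull rdiag_mulr.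
rewrite -mulrBl -rmorphB cmodM exprMn cmod_real; congr (_ * _).
by rewrite -normrX ger0_norm ?sqr_ge0.
Qed.

Lemma char_poly_unitary_conj n (V X : 'M[C]_n) :
  V \is unitarymx -> char_poly (V^t* *m X *m V) = char_poly X.
Proof.
move=> /unitarymxP/mulmx1C VV; rewrite /char_poly /char_poly_mx.
have VVp : map_mx polyC (V^t*) *m map_mx polyC V = 1%:M.
  by rewrite -map_mxM VV map_mx1.
have -> : 'X%:M - map_mx polyC (V^t* *m X *m V) =
    map_mx polyC (V^t*) *m ('X%:M - map_mx polyC X) *m map_mx polyC V.
  rewrite mulmxBr mulmxBl !map_mxM; congr (_ - _).
  by rewrite -mulmxA mul_scalar_mx -scalemxAr VVp scalemx1.
by rewrite !det_mulmx mulrAC -det_mulmx VVp det1 mul1r.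
Qed.

(** The spectral theorem with eigenvalues listed in nonincreasing order.
    The eigenvectors are permuted so that the diagonal factor is literally
    [Eig_down X]: the roots of the characteristic polynomial agree with the
    diagonal up to order by unique factorization. *)
Lemma hermitian_Eig_down n (X : 'M[C]_n) : X \is hermsymmx ->
  exists V : 'M[C]_n, exists l : 'I_n -> R,
  [/\ V \is unitarymx, X = V^t* *m rdiag l *m V,
      forall i j : 'I_n, (i <= j)%N -> l j <= l i &
      Eig_down X = rdiag l].
Proof.
move=> Xh; have Vu := spectral_unitarymx X.
have XE : X = (spectralmx X)^t* *m diag_mx (spectral_diag X) *m spectralmx X.
  by rewrite -invmx_unitary //; apply/orthomx_spectralP; exact: hermitian_normalmx.
have dr i : spectral_diag X 0 i \is Num.real.
  exact: (mxOverP (hermitian_spectral_diag_real Xh)).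
set V := spectralmx X in Vu XE; set d := spectral_diag X in XE dr.
have eigE : perm_eq (eigenvalues X) [tuple d 0 i | i < n].
  apply: prod_XsubC_eq; rewrite -eigenvaluesP {1}XE char_poly_unitary_conj //.
  rewrite char_poly_trig ?diag_mx_is_trig // big_image /=.
  by apply: eq_bigr => i _; rewrite mxE eqxx.
set s := sort >=%R (eigenvalues X).
have sE : perm_eq s [tuple d 0 i | i < n] by rewrite perm_sort.
have eig_real : all (mem Num.real) (eigenvalues X).
  apply/allP => z; rewrite (perm_mem eigE) => /tnthP[i ->].
  by rewrite tnth_mktuple; exact: dr.
have s_sorted : sorted >=%R s.
  apply: sort_sorted_in eig_real => x y xr yr.
  by rewrite real_leVge.
have /tuple_permP[p sp] := sE.
have sn i : s`_(i : 'I_n) = d 0 (p i).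
  rewrite sp /= (nth_map i) ?size_enum_ord // nth_ord_enum.
  by rewrite tnth_mktuple.
have sz : size s = n by rewrite (perm_size sE) size_tuple.
exists (row_perm p V), (fun i => complex.Re (s`_i)).
have pV : row_perm p V \is unitarymx.
  apply/unitarymxP; rewrite row_permE trmx_mul map_mxM mulmxA.
  rewrite mulmxtVK // -row_permE; apply/matrixP => i j.
  by rewrite !mxE (inj_eq perm_inj) rmorph_nat eq_sym.
have rdE : rdiag (fun i : 'I_n => complex.Re s`_i) = diag_mx (\row_i s`_i).
  congr diag_mx; apply/rowP => i; rewrite !mxE RRe_real //.
  by rewrite sn dr.
split=> //.
- rewrite rdE {1}XE; apply/matrixP => i j; rewrite !mul_mx_diag !mxE.
  rewrite (reindex_inj (@perm_inj _ p)) /=; apply: eq_bigr => k _.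
  by rewrite !mxE sn.
- move=> i j ij; have := sorted_leq_nth (rev_trans le_trans) lexx 0 s_sorted.
  move=> /(_ i j); rewrite !inE sz !ltn_ord => /(_ isT isT ij).
  by rewrite lecE => /andP[].
Qed.

Lemma unitary_row_sum n (S : 'M[C]_n) i : S \is unitarymx ->
  \sum_j cmod (S i j) ^+ 2 = 1.
Proof.
move=> /unitarymxP/matrixP/(_ i i)/(congr1 (@complex.Re R)).
rewrite !mxE eqxx /= Re_sum => <-; apply: eq_bigr => j _.
by rewrite !mxE mulrC Re_conjM cmod_sqr !expr2.
Qed.

Lemma unitary_col_sum n (S : 'M[C]_n) j : S \is unitarymx ->
  \sum_i cmod (S i j) ^+ 2 = 1.
Proof.
move=> Su; rewrite -(@unitary_row_sum _ S^T j) ?trmx_unitary //.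
by apply: eq_bigr => i _; rewrite mxE.
Qed.

(** With X = V^H diag(l) V and Y = W^H diag(m) W, the square of |X - Y| is the
    sum of P i j * (l i - m j)^2, where P i j is the squared modulus of the
    entries of the unitary matrix V W^H, hence doubly stochastic.  Expanding
    the squares reduces the claim to the rearrangement inequality. *)
Theorem hoffman_wielandt n (X Y : 'M[C]_n) :
  X \is hermsymmx -> Y \is hermsymmx ->
  frob (Eig_down X - Eig_down Y) <= frob (X - Y).
Proof.
move=> /hermitian_Eig_down[V [l [Vu XE l_dec ->]]].
move=> /hermitian_Eig_down[W [m [Wu YE m_dec ->]]].
rewrite -(@ler_pXn2r _ 2) ?nnegrE ?frob_ge0 //.
have -> : X - Y = X *m 1%:M - 1%:M *m Y by rewrite mulmx1 mul1mx.
rewrite XE YE frob_sylvester_diag // mulmx1.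
have Su : V *m W^t* \is unitarymx by rewrite mul_unitarymx // trmxC_unitary.
have diffE : rdiag l - rdiag m = rdiag (fun i => l i - m i).
  by apply/matrixP => i j; rewrite !mxE rmorphB mulrnBl.
have -> : frob (rdiag l - rdiag m) ^+ 2 = \sum_i (l i - m i) ^+ 2.
  rewrite diffE frob_sqrE; apply: eq_bigr => i _.
  rewrite (bigD1 i) //= big1 => [|j ji]; last first.
    by rewrite !mxE eq_sym (negPf ji) cmod_real normr0 expr0n.
  by rewrite !mxE eqxx mulr1n addr0 cmod_real -normrX ger0_norm ?sqr_ge0.
pose P i j := cmod ((V *m W^t*) i j) ^+ 2.
have Prow i : \sum_j P i j = 1 by exact: unitary_row_sum.
have Pcol j : \sum_i P i j = 1 by exact: unitary_col_sum.
have PE : \sum_i \sum_j P i j * (l i * m j) <= \sum_i l i * m i.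
  by apply: doubly_stochastic_rearrangement => // i j; exact: sqr_ge0.
have -> : \sum_i \sum_j (l i - m j) ^+ 2 * cmod ((V *m W^t*) i j) ^+ 2 =
    \sum_i l i ^+ 2 + \sum_i m i ^+ 2 - 2 * \sum_i \sum_j P i j * (l i * m j).
  have -> : \sum_i l i ^+ 2 = \sum_i \sum_j P i j * l i ^+ 2.
    by apply: eq_bigr => i _; rewrite -mulr_suml Prow mul1r.
  have -> : \sum_i m i ^+ 2 = \sum_i \sum_j P i j * m j ^+ 2.
    rewrite exchange_big /=; apply: eq_bigr => i _.
    by rewrite -mulr_suml Pcol mul1r.
  rewrite -big_split mulr_sumr -sumrB; apply: eq_bigr => i _ /=.
  rewrite -big_split mulr_sumr -sumrB; apply: eq_bigr => j _ /=.
  by rewrite -/(P i j); ring.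
have -> : \sum_i (l i - m i) ^+ 2 =
    \sum_i l i ^+ 2 + \sum_i m i ^+ 2 - 2 * \sum_i l i * m i.
  rewrite -big_split mulr_sumr -sumrB; apply: eq_bigr => i _ /=; ring.
by rewrite lerD2l lerN2 ler_pM2l.
Qed.

Lemma rdiag_eigenvalue n (V : 'M[C]_n) l i :
  V \is unitarymx -> eigenvalue (V^t* *m rdiag l *m V) (l i)%:C.
Proof.
move=> Vu; have VV := unitarymxP Vu; apply/eigenvalueP; exists (row i V).
  rewrite !mulmxA -row_mul VV row1 -rowE; apply/rowP => j.
  by rewrite -row_mul mxE rdiag_mull !mxE.
apply/eqP => Vi0; have /rowP/(_ i) : row i (V *m V^t*) = 0.
  by rewrite row_mul Vi0 mul0mx.
by rewrite VV !mxE eqxx => /eqP; rewrite oner_eq0.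
Qed.

Lemma sylvester_gap m n (X : 'M[C]_m) (Y : 'M[C]_n) (Z : 'M[C]_(m, n)) (d : R) :
  X \is hermsymmx -> Y \is hermsymmx -> 0 <= d ->
  (forall x y, eigenvalue X x -> eigenvalue Y y -> d <= cmod (y - x)) ->
  d * frob Z <= frob (X *m Z - Z *m Y).
Proof.
move=> /hermitian_Eig_down[V [l [Vu -> _ _]]].
move=> /hermitian_Eig_down[W [k [Wu -> _ _]]] d0 gap.
rewrite -(@ler_pXn2r _ 2) ?nnegrE ?mulr_ge0 ?frob_ge0 //.
rewrite frob_sylvester_diag // exprMn.
have -> : frob Z = frob (V *m Z *m W^t*).
  rewrite frob_unitaryr ?trmxCK ?frob_unitaryl // mulmx1C //; exact/unitarymxP.
rewrite frob_sqrE mulr_sumr; apply: ler_sum => i _.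
rewrite mulr_sumr; apply: ler_sum => j _.
apply: ler_wpM2r; first exact: sqr_ge0.
rewrite -[leRHS]real_normK ?num_real // ler_pXn2r ?nnegrE //.
rewrite distrC -cmod_real rmorphB.
by apply: gap; exact: rdiag_eigenvalue.
Qed.

End HoffmanWielandt.

(** * Differentiation of matrix curves *)

Section Derivatives.
Import numFieldTopology.Exports numFieldNormedType.Exports.
Context {R : realType}.
Local Notation C := R[i].
Local Notation Re := (@complex.Re R).
Local Notation Im := (@complex.Im R).

(** At distance |h| <= r / 2 the terms of degree i >= 2 are dominated by
    B * u^i with u = |h| / r <= 1 / 2, whose sum is at most 2 B u^2. *)
Lemma pseries_quadratic_remainder (a : R^nat) (r B h : R) (n : nat) :
  0 < r -> (forall i, `|a i * r ^+ i| <= B) -> `|h| <= r / 2 ->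
  `|pseries a h n.+2 - a 0 - a 1 * h| <= 2 * B / r ^+ 2 * h ^+ 2.
Proof.
move=> r0 aB hr.
pose u := `|h| / r.
have u0 : 0 <= u by rewrite divr_ge0 // ltW.
have u2 : u <= 2^-1 by rewrite ler_pdivrMr // mulrC.
have B0 : 0 <= B by apply: le_trans (aB 0).
have term i : `|a i * h ^+ i| <= B * u ^+ i.
  have -> : a i * h ^+ i = (a i * r ^+ i) * (h / r) ^+ i.
    by rewrite expr_div_n -mulrA [r ^+ i * _]mulrC divfK // expf_neq0 // gt_eqF.
  rewrite normrM; apply: ler_pM => //.
  by rewrite normrX normrM normfV (gtr0_norm r0).
have -> : 2 * B / r ^+ 2 * h ^+ 2 = 2 * B * u ^+ 2.
  by rewrite /u expr_div_n real_normK ?num_real //; field; rewrite gt_eqF.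
(* The stronger bound keeps the tail of the geometric series, for induction. *)
suff : `|pseries a h n.+2 - a 0 - a 1 * h| <=
    2 * B * u ^+ 2 - 2 * B * u ^+ 2 * 2^-1 ^+ n.
  move=> /le_trans; apply; rewrite gerBl.
  have half_ge0 : 0 <= (2^-1 : R) by rewrite invr_ge0.
  apply: mulr_ge0; last exact: exprn_ge0.
  by apply: mulr_ge0; [exact: mulr_ge0|exact: sqr_ge0].
rewrite /pseries /series /=.
elim: n => [|n IH].
  rewrite !big_nat_recl //= big_geq // expr0 expr1 mulr1 addr0.
  have -> : a 0 + a 1 * h - a 0 - a 1 * h = 0 by ring.
  by rewrite normr0 expr0 mulr1 subrr.
rewrite big_nat_recr //=.
have -> (x y z w : R) : x + y - z - w = (x - z - w) + y by ring.
apply: le_trans (ler_normD _ _) _.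
apply: le_trans (lerD IH (term _)) _.
have un : B * u ^+ n.+2 <= B * u ^+ 2 * 2^-1 ^+ n.
  rewrite -mulrA ler_wpM2l // -addn2 addnC exprD ler_wpM2l ?exprn_ge0 //.
  by rewrite lerXn2r // nnegrE invr_ge0.
rewrite [_^-1 ^+ n.+1]exprS.
move: un; set x := _ ^+ n; lra.
Qed.

(** The quadratic remainder bound passes from the partial sums to f, so the
    difference quotient at t differs from a 1 by O(h). *)
Lemma real_analytic_derivable (f : R -> R) (t : R) :
  real_analytic f -> derivable f t 1.
Proof.
move=> /(_ t)[a /nbhs_ballP[e /= e0 ball_cvg]].
have fcvg h : `|h| < e -> pseries a h @ \oo --> f (t + h).
  by move=> he; apply: ball_cvg; rewrite /ball /= sub0r normrN.
pose r := e / 2.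
have r0 : 0 < r by rewrite divr_gt0.
(* Convergence at r bounds the terms a i * r^i. *)
have [B aB] : exists B, forall i, `|a i * r ^+ i| <= B.
  have cr : cvgn (pseries a r).
    by apply: cvgP (fcvg r _); rewrite gtr0_norm // /r gtr_pMr // invf_lt1 // ltr1n.
  have pf := @globally_properfilter nat setT 0%N I.
  by have /ex_bound[B aB] := cvg_series_bounded cr; exists B => i; exact: aB.
pose K := 2 * B / r ^+ 2.
have bound h : `|h| <= r / 2 -> `|f (t + h) - a 0 - a 1 * h| <= K * h ^+ 2.
  move=> hr; have he : `|h| < e.
    by apply: le_lt_trans hr _; rewrite /r; lra.
  have lim : (fun n => `|pseries a h n.+2 - a 0 - a 1 * h|) @ \oo -->
      `|f (t + h) - a 0 - a 1 * h|.
    apply: cvg_norm; apply: cvgB; last exact: cvg_cst.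
    apply: cvgB; last exact: cvg_cst.
    have := fcvg h he; rewrite -(cvg_shiftn 2); under eq_fun do rewrite addn2.
    exact.
  apply: (cvgr_to_le lim).
  by apply: nearW => n; exact: pseries_quadratic_remainder.
(* The remainder bound at h = 0. *)
have ft : f t = a 0.
  have r2 : `|0 : R| <= r / 2 by rewrite normr0 divr_ge0 // ltW.
  have := bound 0 r2; rewrite addr0 expr0n /= !mulr0 subr0 normr_le0.
  by rewrite subr_eq0 => /eqP.
apply/cvg_ex; exists (a 1); apply/cvgrPdist_le => eps eps0.
near=> h.
have h0 : h != 0 by near: h; exact: nbhs_dnbhs_neq.
have hr : `|h| <= r / 2.
  near: h; apply: dnbhs0_le; exact: divr_gt0.
have hK : `|h| <= eps / (`|K| + 1).
  by near: h; apply: dnbhs0_le; rewrite divr_gt0 // ltr_wpDl.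
have -> : a 1 - h^-1 *: (f (h *: 1 + t) - f t) =
    - (h^-1 * (f (t + h) - a 0 - a 1 * h)).
  by rewrite /GRing.scale /= ft mulr1 [h + t]addrC; field.
rewrite normrN normrM normfV ler_pdivrMl ?normr_gt0 //.
apply: le_trans (bound h hr) _.
rewrite -[h ^+ 2]real_normK ?num_real // expr2 mulrA [leRHS]mulrC.
rewrite ler_wpM2r //.
have K1 : 0 < `|K| + 1 by rewrite ltr_wpDl.
apply: (@le_trans _ _ ((`|K| + 1) * `|h|)).
  by rewrite ler_wpM2r // (le_trans (ler_norm K)) // lerDl.
by rewrite mulrC -ler_pdivlMr.
Unshelve. all: by end_near.
Qed.

(** Relational form of [ddt_mx], which carries differentiability along with the
    value of the derivative and so composes under sums and products. *)
Definition has_ddt m n (F : R -> 'M[C]_(m, n)) (t : R) (F' : 'M[C]_(m, n)) :=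
  forall i j, is_derive t 1 (fun s => Re (F s i j)) (Re (F' i j)) /\
              is_derive t 1 (fun s => Im (F s i j)) (Im (F' i j)).

Lemma analytic_has_ddt m n (F : R -> 'M[C]_(m, n)) t :
  analytic_mx F -> has_ddt F t (ddt_mx F t).
Proof.
move=> aF i j; have [/real_analytic_derivable-/(_ t) ReF] := aF i j.
move=> /real_analytic_derivable-/(_ t) ImF.
by rewrite !mxE /= !derive1E; split; apply: DeriveDef.
Qed.

Lemma has_ddt_unique m n (F : R -> 'M[C]_(m, n)) t F1 F2 :
  has_ddt F t F1 -> has_ddt F t F2 -> F1 = F2.
Proof.
move=> h1 h2; apply/matrixP => i j.
have [/@derive_val a1 /@derive_val b1] := h1 i j.
have [/@derive_val a2 /@derive_val b2] := h2 i j.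
by apply/eqP; rewrite eq_complex -a1 -a2 -b1 -b2 !eqxx.
Qed.

Lemma has_ddt_eq m n (F G : R -> 'M[C]_(m, n)) t F' :
  F =1 G -> has_ddt F t F' -> has_ddt G t F'.
Proof. by move=> /funext ->. Qed.

Lemma has_ddt_cst m n (X : 'M[C]_(m, n)) t : has_ddt (fun=> X) t 0.
Proof. by move=> i j; rewrite !mxE; split; exact: is_derive_cst. Qed.

Lemma has_ddtD m n (F G : R -> 'M[C]_(m, n)) t F' G' :
  has_ddt F t F' -> has_ddt G t G' -> has_ddt (fun s => F s + G s) t (F' + G').
Proof.
move=> hF hG i j; have [a b] := hF i j; have [c d] := hG i j.
rewrite mxE ReD ImD; split.
  by under [X in is_derive _ _ X _]funext do rewrite mxE ReD; exact: is_deriveD.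
by under [X in is_derive _ _ X _]funext do rewrite mxE ImD; exact: is_deriveD.
Qed.

Lemma has_ddtM m n p (F : R -> 'M[C]_(m, n)) (G : R -> 'M[C]_(n, p)) t F' G' :
  has_ddt F t F' -> has_ddt G t G' ->
  has_ddt (fun s => F s *m G s) t (F' *m G t + F t *m G').
Proof.
move=> hF hG i j; rewrite !mxE -big_split /= Re_sum Im_sum; split.
  have -> : (fun s => Re ((F s *m G s) i j)) = \sum_(k < n)
      (fun s => Re (F s i k) * Re (G s k j) - Im (F s i k) * Im (G s k j)).
    apply/funext => s; rewrite mxE Re_sum fct_sumE.
    by apply: eq_bigr => k _; rewrite ReM.
  apply: is_derive_sum => k.
  have [a b] := hF i k; have [c d] := hG k j.
  apply: is_derive_eq; rewrite /GRing.scale /= ReD !ReM; ring.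
have -> : (fun s => Im ((F s *m G s) i j)) = \sum_(k < n)
    (fun s => Re (F s i k) * Im (G s k j) + Im (F s i k) * Re (G s k j)).
  apply/funext => s; rewrite mxE Im_sum fct_sumE.
  by apply: eq_bigr => k _; rewrite ImM.
apply: is_derive_sum => k.
have [a b] := hF i k; have [c d] := hG k j.
apply: is_derive_eq; rewrite /GRing.scale /= ImD !ImM; ring.
Qed.

Lemma has_ddtZ_id m n (X : 'M[C]_(m, n)) t : has_ddt (fun s => s%:C *: X) t X.
Proof.
move=> i j; split.
  have -> : (fun s : R => Re ((s%:C *: X) i j)) = (fun s => s * Re (X i j)).
    by apply/funext => s; rewrite mxE ReM /= mul0r subr0.
  by apply: is_derive_eq; rewrite /GRing.scale /= mulr0 add0r mulr1.
have -> : (fun s : R => Im ((s%:C *: X) i j)) = (fun s => s * Im (X i j)).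
  by apply/funext => s; rewrite mxE ImM /= mul0r addr0.
by apply: is_derive_eq; rewrite /GRing.scale /= mulr0 add0r mulr1.
Qed.

Lemma has_ddt_col_mx m1 m2 n (F : R -> 'M[C]_(m1, n)) (G : R -> 'M[C]_(m2, n))
    t F' G' :
  has_ddt F t F' -> has_ddt G t G' ->
  has_ddt (fun s => col_mx (F s) (G s)) t (col_mx F' G').
Proof.
move=> hF hG i j; rewrite mxE.
under [X in is_derive _ _ X _ /\ _]funext do rewrite mxE.
under [X in _ /\ is_derive _ _ X _]funext do rewrite mxE.
by case: (fintype.split i) => k; [exact: hF|exact: hG].
Qed.

Lemma has_ddt_dotR m n (F : R -> 'M[C]_(m, n)) t F' (D : 'M[C]_(m, n)) :
  has_ddt F t F' -> is_derive t 1 (fun s => dotR D (F s)) (dotR D F').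
Proof.
move=> hF.
have -> : (fun s => dotR D (F s)) = \sum_i \sum_j
    (fun s => Re (D i j) * Re (F s i j) + Im (D i j) * Im (F s i j)).
  apply/funext => s; rewrite dotRE fct_sumE; apply: eq_bigr => i _.
  by rewrite fct_sumE.
rewrite dotRE; apply: is_derive_sum => i; apply: is_derive_sum => j.
have [a b] := hF i j; apply: is_derive_eq; rewrite /GRing.scale /=; ring.
Qed.

(** Apply the scalar mean value theorem to the inner product of F with the
    fixed direction F b - F a. *)
Lemma mean_value_frob m n (F F' : R -> 'M[C]_(m, n)) (a b c : R) :
  a <= b -> (forall t, has_ddt F t (F' t)) ->
  (forall t, a <= t <= b -> frob (F' t) <= c) ->
  frob (F b - F a) <= c * (b - a).
Proof.
move=> ab hF Fc; set D := F b - F a.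
have [||x xab] := @MVT_segment R (fun s => dotR D (F s))
  (fun s => dotR D (F' s)) a b ab.
- by move=> x _; exact: has_ddt_dotR.
- apply: derivable_within_continuous => x _.
  by have [] := has_ddt_dotR D (hF x).
rewrite -dotRNr -dotRDr -/D -frob_sqr => Dx.
have c0 : 0 <= c by apply: le_trans (frob_ge0 _) (Fc a _); rewrite lexx.
have [->|D0] := eqVneq (frob D) 0; first by rewrite mulr_ge0 // subr_ge0.
have D_gt0 : 0 < frob D by rewrite lt_neqAle eq_sym D0 frob_ge0.
rewrite -(ler_pM2l D_gt0) -expr2 Dx mulrA ler_wpM2r ?subr_ge0 //.
apply: le_trans (dotR_le _ _) _.
by rewrite ler_wpM2l ?frob_ge0 // Fc.
Qed.

End Derivatives.

(** * The perturbation bound for a single block *)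

Section BlockPerturbation.
Context {R : realType} {n k : nat} {A dA : 'M[R[i]]_n} {r : 'I_k.+1 -> nat}.
Context {U : forall j : 'I_k.+1, R -> 'M[R[i]]_(n, r j)}.
Context {L : forall j : 'I_k.+1, R -> 'M[R[i]]_(r j)}.
Context {U' : R -> 'M[R[i]]_(n, r ord0)} {L' : R -> 'M[R[i]]_(r ord0)}.
Context (At_herm : forall t : R, (A + t%:C *: dA)^t* = A + t%:C *: dA).
Context (U_res : forall t, \sum_j U j t *m (U j t)^t* = 1%:M).
Context (U_orth : forall t j, j != ord0 -> (U j t)^t* *m U ord0 t = 0).
Context (U_isom : forall t, (U ord0 t)^t* *m U ord0 t = 1%:M).
Context (AU : forall t j, (A + t%:C *: dA) *m U j t = U j t *m L j t).
Context (L_herm : forall t j, L j t \is hermsymmx).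
Context (U_ddt : forall t, has_ddt (U ord0) t (U' t)).
Context (L_ddt : forall t, has_ddt (L ord0) t (L' t)).
Context (gauge : forall t, (U ord0 t)^t* *m U' t = 0).

(** The two sides are the derivatives of the two sides of A(t) U1 = U1 L1. *)
Lemma ddt_invariance t :
  dA *m U ord0 t + (A + t%:C *: dA) *m U' t =
  U' t *m L ord0 t + U ord0 t *m L' t.
Proof.
have At_ddt : has_ddt (fun s : R => A + s%:C *: dA) t (0 + dA).
  by apply: has_ddtD; [exact: has_ddt_cst|exact: has_ddtZ_id].
have := has_ddtM At_ddt (U_ddt t); rewrite add0r => h.
apply: (has_ddt_unique h).
apply: has_ddt_eq (has_ddtM (U_ddt t) (L_ddt t)) => s.
by rewrite AU.
Qed.

(** Each block spans an invariant subspace on the left as well, as A(t) and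
    L j t are Hermitian. *)
Lemma adjoint_block_mul t j : (U j t)^t* *m (A + t%:C *: dA) = L j t *m (U j t)^t*.
Proof.
have := L_herm t j; move/is_hermitianmxP; rewrite expr0 scale1r => ->.
by rewrite -map_mxM -trmx_mul -AU trmx_mul map_mxM At_herm.
Qed.

Lemma ddt_diagonal_block t : (U ord0 t)^t* *m (dA *m U ord0 t) = L' t.
Proof.
have /(congr1 (mulmx ((U ord0 t)^t*))) := ddt_invariance t.
have e1 : (U ord0 t)^t* *m ((A + t%:C *: dA) *m U' t) = 0.
  by rewrite mulmxA adjoint_block_mul -mulmxA gauge mulmx0.
have e2 : (U ord0 t)^t* *m (U' t *m L ord0 t) = 0.
  by rewrite mulmxA gauge mul0mx.
by rewrite !mulmxDr e1 e2 addr0 add0r (mulmxA _ (U ord0 t)) U_isom mul1mx.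
Qed.

Lemma ddt_offdiagonal_block t j : j != ord0 ->
  (U j t)^t* *m (dA *m U ord0 t) =
  - (L j t *m ((U j t)^t* *m U' t) - (U j t)^t* *m U' t *m L ord0 t).
Proof.
move=> j0; have /(congr1 (mulmx ((U j t)^t*))) := ddt_invariance t.
have e1 : (U j t)^t* *m ((A + t%:C *: dA) *m U' t) =
    L j t *m ((U j t)^t* *m U' t).
  by rewrite mulmxA adjoint_block_mul mulmxA.
have e2 : (U j t)^t* *m (U ord0 t *m L' t) = 0.
  by rewrite mulmxA U_orth // mul0mx.
rewrite !mulmxDr e1 e2 addr0 (mulmxA _ (U' t)) => <-.
by rewrite opprB addrK.
Qed.

(** Split both U1' and dA U1 along the blocks.  The first block contributes L1'
    on the right and nothing for U1' (gauge); every other block is controlled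
    by the expansion of the corresponding Sylvester operator. *)
Lemma velocity_bound t (d : R) : 0 <= d ->
  (forall j x y, j != ord0 -> eigenvalue (L ord0 t) x -> eigenvalue (L j t) y ->
    d <= cmod (x - y)) ->
  frob (L' t) ^+ 2 + d ^+ 2 * frob (U' t) ^+ 2 <= frob (dA *m U ord0 t) ^+ 2.
Proof.
move=> d0 gap.
rewrite (frob_sum_resolution (U' t) (U_res t)).
rewrite (frob_sum_resolution (dA *m U ord0 t) (U_res t)).
rewrite (bigD1 ord0) //= gauge frob0 expr0n add0r.
rewrite [leRHS](bigD1 ord0) //= ddt_diagonal_block lerD2l mulr_sumr.
apply: ler_sum => j j0; rewrite ddt_offdiagonal_block // frobN -exprMn.
rewrite ler_pXn2r ?nnegrE ?mulr_ge0 ?frob_ge0 //.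
by apply: sylvester_gap => // x y xj y0; apply: gap xj.
Qed.

Lemma frob_first_block t : frob (U ord0 t) = frob (1%:M : 'M[R[i]]_(r ord0)).
Proof. by rewrite -[U ord0 t]mulmx1 frob_unitaryl. Qed.

(** A bound on the speed by a + s m and the mean value inequality bound m
    itself, by absorbing s m into the left-hand side; a second application of
    the mean value inequality, to the curve (L1, d U1), gives the result. *)
Lemma block_perturbation_bound (d : R) : spectral_norm dA < d ->
  (forall t j x y, 0 <= t <= 1 -> j != ord0 ->
    eigenvalue (L ord0 t) x -> eigenvalue (L j t) y -> d <= cmod (x - y)) ->
  (1 - spectral_norm dA / d) ^+ 2 * frob (L ord0 1 - L ord0 0) ^+ 2
    + (d - spectral_norm dA) ^+ 2 * frob (U ord0 1 - U ord0 0) ^+ 2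
  <= frob (dA *m U ord0 0) ^+ 2.
Proof.
set s := spectral_norm dA => sd gap.
have s0 : 0 <= s by exact: spectral_norm_ge0.
have d_gt0 : 0 < d by exact: le_lt_trans s0 sd.
set a := frob (dA *m _).
pose E t := frob (U ord0 t - U ord0 0).
pose S := [set E t | t in [set t : R | 0 <= t <= 1]].
have supS : has_sup S.
  split; first by exists (E 0), 0 => //=; rewrite lexx ler01.
  exists (2 * frob (1%:M : 'M[R[i]]_(r ord0))) => _ [t _ <-].
  by rewrite (le_trans (frobD _ _)) // frobN !frob_first_block mulr_natl mulr2n.
pose m := sup S.
have Em t : 0 <= t <= 1 -> E t <= m.
  by move=> t01; apply: sup_upper_bound => //; exists t.
have m0 : 0 <= m by apply: le_trans (frob_ge0 _) (Em 0 _); rewrite lexx ler01.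
pose c := a + s * m.
have c0 : 0 <= c by rewrite addr_ge0 ?mulr_ge0 ?frob_ge0.
have speed t : 0 <= t <= 1 ->
    frob (L' t) ^+ 2 + d ^+ 2 * frob (U' t) ^+ 2 <= c ^+ 2.
  move=> t01; have gap_t j x y := gap t j x y t01.
  apply: le_trans (velocity_bound (ltW d_gt0) gap_t) _.
  rewrite ler_pXn2r ?nnegrE ?frob_ge0 //.
  have -> : dA *m U ord0 t = dA *m U ord0 0 + dA *m (U ord0 t - U ord0 0).
    by rewrite -mulmxDr subrKC.
  apply: le_trans (frobD _ _) _; rewrite lerD2l.
  by apply: le_trans (frob_mulmx_spectral _ _) _; rewrite ler_wpM2l // Em.
have m_le : m <= c / d.
  apply: ge_sup => [|_ [t /andP[t0 t1] <-]]; first by case: supS.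
  have U'c u : 0 <= u <= t -> frob (U' u) <= c / d.
    move=> /andP[u0 ut]; rewrite ler_pdivlMr // mulrC.
    rewrite -(@ler_pXn2r _ 2) ?nnegrE ?mulr_ge0 ?frob_ge0 ?(ltW d_gt0) // exprMn.
    apply: le_trans (speed u _); first by rewrite lerDr sqr_ge0.
    by rewrite u0 (le_trans ut).
  apply: le_trans (mean_value_frob t0 U_ddt U'c) _.
  by rewrite subr0 ler_piMr // divr_ge0 // ltW.
(* Absorption: c = a + s m and m <= c / d. *)
have cd : (1 - s / d) * c <= a.
  have md : m * d <= c by rewrite -ler_pdivlMr.
  rewrite -(ler_pM2l d_gt0).
  have -> : d * ((1 - s / d) * c) = (d - s) * c by field; rewrite gt_eqF.
  rewrite /c in md *; nra.
pose G t := col_mx (L ord0 t) (d%:C%:M *m U ord0 t).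
have G_ddt t : has_ddt G t (col_mx (L' t) (d%:C *: U' t)).
  apply: has_ddt_col_mx; first exact: L_ddt.
  have := has_ddtM (has_ddt_cst d%:C%:M t) (U_ddt t).
  by rewrite mul0mx add0r mul_scalar_mx.
have frobG X Y : frob (col_mx X (d%:C *: Y) : 'M[R[i]]_(_, r ord0)) ^+ 2 =
    frob X ^+ 2 + d ^+ 2 * frob Y ^+ 2.
  by rewrite frob_col_mx frobZ cmod_real (gtr0_norm d_gt0) exprMn.
have Gc t : 0 <= t <= 1 -> frob (col_mx (L' t) (d%:C *: U' t)) <= c.
  move=> t01; rewrite -(@ler_pXn2r _ 2) ?nnegrE ?frob_ge0 //.
  by rewrite frobG speed.
have := mean_value_frob ler01 G_ddt Gc; rewrite subr0 mulr1.
have -> : G 1 - G 0 = col_mx (L ord0 1 - L ord0 0) (d%:C *: (U ord0 1 - U ord0 0)).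
  by rewrite /G opp_col_mx add_col_mx -mulmxBr mul_scalar_mx.
rewrite -(@ler_pXn2r _ 2) ?nnegrE ?frob_ge0 // frobG => Gle.
have q0 : 0 <= 1 - s / d by rewrite subr_ge0 ler_pdivrMr // mul1r ltW.
have -> : d - s = (1 - s / d) * d by field; rewrite gt_eqF.
rewrite [((1 - s / d) * d) ^+ 2]exprMn -[X in _ + X <= _]mulrA -mulrDr.
apply: le_trans (ler_wpM2l (sqr_ge0 _) Gle) _.
by rewrite -exprMn ler_pXn2r ?nnegrE ?mulr_ge0 ?frob_ge0.
Qed.

End BlockPerturbation.

(** * Blocks of a unitary matrix *)

Section BlockDecomposition.
Context {R : realType}.
Local Notation C := R[i].

Lemma mxrow_ctr m p (q : 'I_p -> nat) (B : forall j, 'M[C]_(m, q j)) :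
  (\mxrow_j B j)^t* = \mxcol_j (B j)^t*.
Proof. by apply/matrixP => i j; rewrite !mxE. Qed.

Lemma analytic_mxrow_block m p (q : 'I_p -> nat)
    (B : forall j, R -> 'M[C]_(m, q j)) j :
  analytic_mx (fun t => \mxrow_l B l t) -> analytic_mx (B j).
Proof.
move=> aB a b; have := aB a (tagnat.Rank j b).
suff E t : (\mxrow_l B l t) a (tagnat.Rank j b) = B j t a b.
  by under eq_fun do rewrite E; under [X in _ /\ real_analytic X]eq_fun do rewrite E.
by rewrite -[in RHS](mxrowK (fun l => B l t) j) [RHS]mxE.
Qed.

Lemma analytic_mxdiag_block p (q : 'I_p -> nat)
    (B : forall j, R -> 'M[C]_(q j)) j :
  analytic_mx (fun t => \mxdiag_l B l t) -> analytic_mx (B j).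
Proof.
move=> aB a b; have := aB (tagnat.Rank j a) (tagnat.Rank j b).
suff E t : (\mxdiag_l B l t) (tagnat.Rank j a) (tagnat.Rank j b) = B j t a b.
  by under eq_fun do rewrite E; under [X in _ /\ real_analytic X]eq_fun do rewrite E.
by rewrite -[in RHS](submxblock_diag (fun l => B l t) j) [RHS]mxE.
Qed.

Lemma unitary_mxrow_resolution m p (q : 'I_p -> nat)
    (B : forall j, 'M[C]_(m, q j)) :
  \mxrow_j B j \is unitarymx -> \sum_j B j *m (B j)^t* = 1%:M.
Proof. by move=> /unitarymxP; rewrite mxrow_ctr mul_mxrow_mxcol. Qed.

(** The conform_mx form is the one under which the identity is block diagonal;
    it is the identity matrix when i = j. *)
Lemma unitary_mxrow_orthonormal p (q : 'I_p -> nat)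
    (B : forall j, 'M[C]_(\sum_j q j, q j)) i j :
  \mxrow_j B j \is unitarymx ->
  (B i)^t* *m B j = if i == j then conform_mx 0 (1%:M : 'M[C]_(q i)) else 0.
Proof.
move=> /unitarymxP/mulmx1C; rewrite mxrow_ctr mul_mxcol_mxrow.
by rewrite -mxdiagZ /mxdiag => /eq_mxblockP ->.
Qed.

End BlockDecomposition.

(** * The gap as an extended real *)

Section ExtendedGap.
Context {R : realType}.

Lemma delta1_min_le (k : nat) (r : 'I_k.+1 -> nat)
    (L : forall j : 'I_k.+1, R -> 'M[R[i]]_(r j)) t j x y :
  0 <= t <= 1 -> j != ord0 ->
  eigenvalue (L ord0 t) x -> eigenvalue (L j t) y ->
  (delta1_min L <= (cmod (x - y))%:E)%E.
Proof.
move=> t01 j0 xL yL.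
apply: (@le_trans _ _ (delta1 L t)).
  by apply: ereal_inf_lbound; exists t => //=; rewrite in_itv.
apply: (le_trans (bigmin_le_cond +oo%E (fun i => delta1i L i t) j0)).
by apply: ereal_inf_lbound; exists x => //; exists y.
Qed.

(** When D is infinite the inequality for arbitrarily large real d forces u = 0,
    since (d - s)^2 u^2 stays below a^2, and then e <= a, since (1 - s / d) e
    stays below a. *)
Lemma ereal_gap_bound (s e u a : R) (D : \bar R) :
  0 <= s -> 0 <= e -> 0 <= u -> 0 <= a -> (s%:E < D)%E ->
  (forall d : R, s < d -> (d%:E <= D)%E ->
    (1 - s / d) ^+ 2 * e ^+ 2 + (d - s) ^+ 2 * u ^+ 2 <= a ^+ 2) ->
  ((1 - s%:E / D) ^+ 2 * e%:E ^+ 2 + (D - s%:E) ^+ 2 * u%:E ^+ 2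
    <= a%:E ^+ 2)%E.
Proof.
move=> s0 e0 u0 a0; case: D => [d| |].
- rewrite lte_fin => sd /(_ d sd (lexx _)) bound.
  by rewrite inver gt_eqF ?(le_lt_trans s0 sd) // -EFinM -!EFinB
    -!EFin_expe -!EFinM -EFinD lee_fin.
- move=> _ bound.
  have u_eq0 : u = 0.
    apply/eqP; rewrite eq_le u0 andbT leNgt; apply/negP => u_gt0.
    (* Chosen so that (d - s) u = a + 1 > a. *)
    pose d := s + (a + 1) / u.
    have sd : s < d by rewrite ltrDl divr_gt0 // ltr_wpDl.
    have := bound d sd (leey _).
    have -> : (d - s) ^+ 2 * u ^+ 2 = (a + 1) ^+ 2.
      by rewrite /d; field; rewrite gt_eqF.
    have : 0 <= (1 - s / d) ^+ 2 * e ^+ 2 by rewrite mulr_ge0 ?sqr_ge0.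
    nra.
  have e_le : e <= a.
    rewrite leNgt; apply/negP => ae.
    have ea : 0 < e - a by rewrite subr_gt0.
    (* For d = s + x the bound reads x (e - a) <= a s; this x makes the
       left-hand side a s + 1. *)
    pose x := (a * s + 1) / (e - a).
    have x0 : 0 < x by rewrite divr_gt0 // ltr_wpDl // mulr_ge0.
    have sx : s < s + x by rewrite ltrDl.
    have := bound _ sx (leey _).
    rewrite u_eq0 expr0n /= mulr0 addr0 -exprMn.
    have -> : 1 - s / (s + x) = x / (s + x) by field; rewrite gt_eqF // ltr_wpDl.
    have sx0 : 0 < s + x by rewrite ltr_wpDl.
    have xe0 : 0 <= x / (s + x) * e by rewrite mulr_ge0 // divr_ge0 // ltW.
    rewrite ler_pXn2r ?nnegrE //.
    rewrite mulrAC ler_pdivrMr //.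
    have : x * (e - a) = a * s + 1 by rewrite /x divfK // gt_eqF.
    nra.
  rewrite invey mule0 sube0 u_eq0 expe2 mule1 mul1e.
  rewrite [(0%:E ^+ 2)%E]expe2 mule0 mule0 adde0 -!EFin_expe lee_fin.
  by rewrite ler_pXn2r ?nnegrE.
- by rewrite ltNge leNye.
Qed.

End ExtendedGap.

Theorem theorem2p2 (R : realType) (n k : nat) (A dA : 'M[R[i]]_n)
    (r : 'I_k.+1 -> nat)
    (U : forall j : 'I_k.+1, R -> 'M[R[i]]_(n, r j))
    (L : forall j : 'I_k.+1, R -> 'M[R[i]]_(r j))
    (A_herm : A \is hermsymmx) (dA_herm : dA \is hermsymmx)
    (r_gt0 : forall j, (0 < r j)%N)
    (r_sum : (\sum_(j < k.+1) r j)%N = n)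
    (decomp : forall t : R,
       A + t%:C *: dA =
       (\mxrow_(j < k.+1) U j t) *m (\mxdiag_(j < k.+1) L j t)
         *m (\mxrow_(j < k.+1) U j t)^t*)
    (U_unitary : forall t : R, (\mxrow_(j < k.+1) U j t) \is unitarymx)
    (U_analytic : analytic_mx (fun t => \mxrow_(j < k.+1) U j t))
    (L_analytic : analytic_mx (fun t => \mxdiag_(j < k.+1) L j t))
    (U_gauge : forall (j : 'I_k.+1) (t : R),
       (U j t)^t* *m ddt_mx (U j) t = 0)
    (gap : ((spectral_norm dA)%:E < delta1_min L)%E) :
  ((1 - (spectral_norm dA)%:E / delta1_min L) ^+ 2
     * (frob (Eig_down (L ord0 1) - Eig_down (L ord0 0)))%:E ^+ 2
   + (delta1_min L - (spectral_norm dA)%:E) ^+ 2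
     * (frob (U ord0 1 - U ord0 0))%:E ^+ 2
   <= (frob (dA *m U ord0 0))%:E ^+ 2)%E.
Proof.
move: A dA A_herm dA_herm U decomp U_unitary U_analytic U_gauge gap.
case: n / r_sum => A dA A_herm dA_herm U decomp U_unitary U_analytic U_gauge gap.
pose W t := \mxrow_(j < k.+1) U j t.
have At_herm (t : R) : (A + t%:C *: dA)^t* = A + t%:C *: dA.
  move: A_herm dA_herm => /is_hermitianmxP; rewrite expr0 scale1r => AH.
  move=> /is_hermitianmxP; rewrite expr0 scale1r => dAH.
  rewrite raddfD /= map_mxD -AH linearZ /= map_mxZ -dAH.
  by congr (_ + _ *: _); exact/CrealP/complex_realP/ex_intro.
have WW t : (W t)^t* *m W t = 1%:M by apply/mulmx1C/unitarymxP; exact: U_unitary.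
have AU t j : (A + t%:C *: dA) *m U j t = U j t *m L j t.
  have : (A + t%:C *: dA) *m W t = W t *m \mxdiag_(j < k.+1) L j t.
    by rewrite decomp -mulmxA WW mulmx1.
  by rewrite mul_mxrow mul_mxrow_mxdiag => /eq_mxrowP ->.
have U_orth t i j := unitary_mxrow_orthonormal i j (U_unitary t).
have U_isom t j : (U j t)^t* *m U j t = 1%:M.
  by rewrite U_orth eqxx conform_mx_id.
have L_herm t j : L j t \is hermsymmx.
  have LE : L j t = (U j t)^t* *m (A + t%:C *: dA) *m U j t.
    by rewrite -mulmxA AU mulmxA U_isom mul1mx.
  apply/is_hermitianmxP; rewrite expr0 scale1r LE.
  by rewrite !trmx_mul !map_mxM /= trmxCK At_herm mulmxA.
have gap_le t j x y : 0 <= t <= 1 -> j != ord0 ->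
    eigenvalue (L ord0 t) x -> eigenvalue (L j t) y ->
    (delta1_min L <= (cmod (x - y))%:E)%E by exact: delta1_min_le.
apply: ereal_gap_bound; rewrite ?frob_ge0 ?spectral_norm_ge0 // => d sd dD.
apply: le_trans (block_perturbation_bound (d := d) (U := U) (L := L)
  At_herm _ _ _ AU L_herm _ _ _ sd _).
- rewrite lerD2r ler_wpM2l ?sqr_ge0 // ler_pXn2r ?nnegrE ?frob_ge0 //.
  exact: hoffman_wielandt.
- by move=> t; exact: unitary_mxrow_resolution.
- by move=> t j j0; rewrite U_orth (negPf j0).
- by move=> t; exact: U_isom.
- by move=> t; apply: analytic_has_ddt; exact: analytic_mxrow_block U_analytic.
- by move=> t; apply: analytic_has_ddt; exact: analytic_mxdiag_block L_analytic.
- by move=> t; exact: U_gauge.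
- move=> t j x y t01 j0 xL yL; rewrite -lee_fin.
  exact: le_trans dD (gap_le t j x y t01 j0 xL yL).
Qed.
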